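(* Let $1\le m\le n$ be integers, let $f:\mathrm{Gr}_{m,n}\to\mathbb{R}$ be a smooth function and let $P^{*}\in\mathrm{Gr}_{m,n}$ be a nondegenerate critical point of $f$. Let $\{\mu_P\}_{P\in\mathrm{Gr}_{m,n}}$ and $\{\nu_P\}_{P\in\mathrm{Gr}_{m,n}}$ be two families of local parametrizations of $\mathrm{Gr}_{m,n}$, both locally smooth around $P^{*}$. Suppose that $$D\mu_{P^{*}}(0)=D\nu_{P^{*}}(0).$$ Then there exists an open neighborhood $V\subset\mathrm{Gr}_{m,n}$ of $P^{*}$ such that, whenever $P_0\in V$, the point sequence $\{P_k\}_{k\ge 0}$ generated by $$P_{k+1}=\nu_{P_k}\big(N_{f\circ\mu_{P_k}}(0)\big),\qquad k\ge 0,$$ converges quadratically to $P^{*}$.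
   Context: $\mathrm{Gr}_{m,n}=\{P\in\mathbb{R}^{n\times n}: P^{\top}=P,\ P^2=P,\ \operatorname{tr}P=m\}$, a smooth compact submanifold, of dimension $m(n-m)$, of the space of real symmetric $n\times n$ matrices. A local parametrization around $P\in\mathrm{Gr}_{m,n}$ is a smooth map $\mu_P:\mathbb{R}^{m(n-m)}\to\mathrm{Gr}_{m,n}$ with $\mu_P(0)=P$ which is a local diffeomorphism around $0$. A family of local parametrizations $\{\mu_P\}_{P\in\mathrm{Gr}_{m,n}}$ has one such $\mu_P$ for each $P$. It is called locally smooth around $P^{*}$ if there are an open neighborhood $U\subset\mathrm{Gr}_{m,n}$ of $P^{*}$ and a smooth map $\mu:U\times\mathbb{R}^{m(n-m)}\to\mathrm{Gr}_{m,n}$ with $\mu(P,x)=\mu_P(x)$ for all $P\in U$ and $x\in\mathbb{R}^{m(n-m)}$. For a smooth $g:\mathbb{R}^{d}\to\mathbb{R}$ and a point $x$ at which the Hessian operator $\mathrm{Hess}_g(x)$ is invertible, the Euclidean Newton map is $N_g(x)=x-(\mathrm{Hess}_g(x))^{-1}\nabla g(x)$. A critical point $P^{*}$ of $f$ is nondegenerate if the Hessian of $f$ at $P^{*}$ is nondegenerate (equivalently, the Hessian at $0$ of $f\circ\mu_{P^{*}}$ is invertible). Quadratic convergence: all iterates are defined, $P_k\to P^{*}$, and there is a constant $C$ with $\|P_{k+1}-P^{*}\|\le C\|P_k-P^{*}\|^2$ for all $k$. *)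

(* Defs.v *)
From HB Require Import structures.
From mathcomp Require Import all_boot all_order all_algebra.
From mathcomp Require Import all_classical all_reals all_analysis.

Set Implicit Arguments.
Unset Strict Implicit.
Unset Printing Implicit Defensive.

Import Order.TTheory GRing.Theory Num.Theory.
Import numFieldNormedType.Exports.

Local Open Scope classical_set_scope.
Local Open Scope ring_scope.

(* C^k on the set O, meant for O open and V, W finite dimensional, where
   continuity of x |-> 'd f x v for every fixed v is continuity of 'd f. *)
Fixpoint Ck (R : realType) (V W : normedModType R) (k : nat) (O : set V)
    (f : V -> W) : Prop :=
  match k with
  | 0%N => forall x, O x -> {for x, continuous f}
  | k'.+1 => (forall x, O x -> differentiable f x) /\
             (forall v : V, Ck k' O (fun x => 'd f x v))
  end.

(* Smoothness of the restriction of f to an arbitrary subset S: near each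
   point of S it has a C^oo extension to an open subset of V. For an embedded
   submanifold S this is smoothness for the induced manifold structure; the
   values of f outside S play no role. *)
Definition smooth_on (R : realType) (V W : normedModType R) (S : set V)
    (f : V -> W) : Prop :=
  forall x, S x -> exists (O : set V) (F : V -> W),
    [/\ open O, O x, (forall k, Ck k O F) &
        forall y, O y -> S y -> F y = f y].

Definition rel_open (T : topologicalType) (S A : set T) : Prop :=
  exists2 O : set T, open O & A = O `&` S.

Definition Gr (R : realType) (m n : nat) : set 'M[R]_n :=
  [set P | [/\ P^T = P, P *m P = P & \tr P = m%:R]].

Section Grassmannian.
Variables (R : realType) (m n : nat).
Local Notation d := (m * (n - m))%N.
Local Notation Gr := (@Gr R m n).

Definition local_parametrization (P : 'M[R]_n) (phi : 'cV[R]_d -> 'M[R]_n)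
    : Prop :=
  [/\ forall x, Gr (phi x), smooth_on setT phi, phi 0 = P &
      exists (W : set 'cV[R]_d) (A : set 'M[R]_n) (psi : 'M[R]_n -> 'cV[R]_d),
        [/\ open W /\ W 0, rel_open Gr A, phi @` W = A,
            (forall x, W x -> psi (phi x) = x) & smooth_on A psi]].

Definition param_family (mu : 'M[R]_n -> 'cV[R]_d -> 'M[R]_n) : Prop :=
  forall P, Gr P -> local_parametrization P (mu P).

Definition locally_smooth_around (Ps : 'M[R]_n)
    (mu : 'M[R]_n -> 'cV[R]_d -> 'M[R]_n) : Prop :=
  exists U : set 'M[R]_n,
    [/\ rel_open Gr U, U Ps &
        smooth_on (U `*` [set: 'cV[R]_d])
          (fun z : 'M[R]_n * 'cV[R]_d => mu z.1 z.2)].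

Definition Gr_curve (P : 'M[R]_n) (c : R -> 'M[R]_n) : Prop :=
  [/\ forall t, Gr (c t), smooth_on [set: R] c & c 0 = P].

Definition tangent (P : 'M[R]_n) : set 'M[R]_n :=
  [set xi | exists2 c, Gr_curve P c & derive1 c 0 = xi].

Definition critical_point (f : 'M[R]_n -> R) (P : 'M[R]_n) : Prop :=
  Gr P /\ forall c, Gr_curve P c -> derive1 (f \o c) 0 = 0.

(* B restricts to the Hessian of f at the critical point P: the symmetric
   bilinear form on the tangent space whose quadratic form is the second
   derivative of f along curves. At a critical point of a smooth f that
   derivative depends on the velocity of the curve only, so the form exists,
   and it is unique by polarization. *)
Definition is_Hessian (f : 'M[R]_n -> R) (P : 'M[R]_n)
    (B : 'M[R]_n -> 'M[R]_n -> R) : Prop :=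
  [/\ (forall xi eta, tangent P xi -> tangent P eta -> B xi eta = B eta xi),
      (forall (a : R) xi1 xi2 eta,
         tangent P xi1 -> tangent P xi2 -> tangent P eta ->
         B (a *: xi1 + xi2) eta = a * B xi1 eta + B xi2 eta) &
      forall c, Gr_curve P c ->
        derive1n 2 (f \o c) 0 = B (derive1 c 0) (derive1 c 0)].

Definition nondegenerate_critical_point (f : 'M[R]_n -> R) (P : 'M[R]_n)
    : Prop :=
  critical_point f P /\
  exists2 B, is_Hessian f P B &
    forall xi, tangent P xi ->
      (forall eta, tangent P eta -> B xi eta = 0) -> xi = 0.

End Grassmannian.

Definition grad (R : realType) (d : nat) (g : 'cV[R]_d -> R) (x : 'cV[R]_d)
    : 'cV[R]_d :=
  \col_i 'D_(delta_mx i 0) g x.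

Definition hess (R : realType) (d : nat) (g : 'cV[R]_d -> R) (x : 'cV[R]_d)
    : 'M[R]_d :=
  \matrix_(i, j) 'D_(delta_mx i 0) ('D_(delta_mx j 0) g) x.

(* Only meaningful when hess g x \in unitmx. *)
Definition newton_map (R : realType) (d : nat) (g : 'cV[R]_d -> R)
    (x : 'cV[R]_d) : 'cV[R]_d :=
  x - invmx (hess g x) *m grad g x.

Definition newton_seq (R : realType) (n d : nat) (f : 'M[R]_n -> R)
    (mu nu : 'M[R]_n -> 'cV[R]_d -> 'M[R]_n) (P0 : 'M[R]_n) (k : nat)
    : 'M[R]_n :=
  iter k (fun P => nu P (newton_map (f \o mu P) 0)) P0.

(* The norm is the library's (entrywise maximum) norm; as all norms on
   matrices are equivalent, the choice only affects the constant C. *)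
Definition quadratic_cvg (R : realType) (n : nat) (u : nat -> 'M[R]_n)
    (l : 'M[R]_n) : Prop :=
  u @ \oo --> l /\
  exists C : R, forall k, `|u k.+1 - l| <= C * `|u k - l| ^+ 2.

(* Main.v *)
Require Import Defs.
From HB Require Import structures.
From mathcomp Require Import all_boot all_order all_algebra.
From mathcomp Require Import all_classical all_reals all_analysis.
From mathcomp Require Import ring lra.
Import Order.TTheory GRing.Theory Num.Theory.
Import numFieldNormedType.Exports.
Set Implicit Arguments.
Unset Strict Implicit.
Unset Printing Implicit Defensive.
Local Open Scope classical_set_scope.
Local Open Scope ring_scope.

(** Work in the coordinates [y] given by [phi := mu Ps], with local inverse
    [psi]; near the critical point an iterate is [P = phi y]. Put
    [K (y, x) := psi (mu (phi y) x)] and [h := f \o phi], so that [f \o mu P]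
    is [x |-> h (K (y, x))]. Since [K (y, 0) = y],
    [K (0, x) = x] and ['d h 0 = 0], its gradient at [x = 0] is
    [H y + O(|y|^2)] and its Hessian is [H + O(|y|)], where [H] is the Hessian
    of [h] at [0], symmetric by Schwarz and invertible by nondegeneracy. Hence
    the Newton vector is [s = - y + O(|y|^2)]. Finally
    [nu (phi y) s = Ps + 'd phi 0 (y + s) + O(|(y, s)|^2)], because
    [nu (phi y) 0 = phi y] and [nu Ps] has the same differential at [0] as
    [phi]; so one step maps [P] to within [O(|y|^2) = O(|P - Ps|^2)] of [Ps]. *)

(** * Neighbourhood filters *)

Lemma near_open_nbhs (T : topologicalType) (x : T) (P : T -> Prop) :
  (\forall y \near x, P y) -> exists2 O, open_nbhs x O & forall y, O y -> P y.
Proof. by rewrite /prop_near1 nbhsE. Qed.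

Lemma near_comp (T U : topologicalType) (f : T -> U) (x : T) (P : U -> Prop) :
  {for x, continuous f} -> (\forall y \near f x, P y) ->
  \forall y \near x, P (f y).
Proof. by move=> cf H; exact: cf. Qed.

(** The sum of the finitely many constants dominates each of them; the added [1] keeps it positive
    when [I] is empty. *)
Lemma near_le_finite (R : realType) (T : Type) (F : set_system T)
    {FF : Filter F} (I : finType) (f : I -> T -> R) (g : T -> R) :
  (forall z, 0 <= g z) ->
  (forall i, exists2 C, 0 < C & \forall z \near F, f i z <= C * g z) ->
  exists2 C, 0 < C & \forall z \near F, forall i, f i z <= C * g z.
Proof.
move=> g0 H.
have /choice[C HC] i : exists C, 0 < C /\ \forall z \near F, f i z <= C * g z.
  by have [C C0 HC] := H i; exists C.
have C0 i : 0 <= C i by rewrite ltW //; case: (HC i).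
exists (1 + \sum_i C i); first by rewrite ltr_pwDl // sumr_ge0.
have : \forall z \near F, forall i, f i z <= C i * g z.
  by apply: filter_forall => i; have [] := HC i.
apply: filterS => z Hz i; apply: (le_trans (Hz i)).
rewrite ler_wpM2r // (bigD1 i) //= addrCA lerDl addr_ge0 // sumr_ge0 //.
Qed.

(** * Differentials: locality, product rule, chain rule *)

Section Differentials.
Variable R : realType.
Implicit Types V W X : normedModType R.

(** The little-o expansion that characterizes the differential sees only the germ at [x], and its
    linear part is unique. *)
Lemma near_eq_differentiable V W (f g : V -> W) (x : V) :
  (\forall y \near x, f y = g y) -> differentiable f x ->
  differentiable g x /\ 'd g x = 'd f x :> (V -> W).
Proof.
move=> fg df.
have E : g \o shift x = cst (g x) + 'd f x +o_ 0 id.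
  apply/eqaddoP => _/posnumP[e].
  have /eqaddoP/(_ _ [gt0 of e%:num]) H := diff_locally df.
  have fg0 : \forall h \near (0 : V), f (h + x) = g (h + x).
    by move: fg; rewrite (near_shift 0) /=; apply: filterS => h; rewrite /= subr0.
  apply: filterS2 H fg0 => h; rewrite !fctE /= => + Eh.
  by rewrite Eh (nbhs_singleton fg).
have D := diff_unique (diff_continuous df) E.
split=> //; apply/diff_locallyP; rewrite D; split=> //.
exact: diff_continuous.
Qed.

(** Product rule: scaling is a continuous bilinear map, composed here with the pair of [a] and
    [b]. *)
Lemma diff_scale V W (a : V -> R) (b : V -> W) (x : V) :
  differentiable a x -> differentiable b x ->
  differentiable (fun y => a y *: b y) x /\
  'd (fun y => a y *: b y) x = (fun v => a x *: 'd b x v + 'd a x v *: b x)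
    :> (V -> W).
Proof.
move=> da db.
have bil : bilinear_for
    (GRing.Scale.Law.clone _ _ *:%R _) (GRing.Scale.Law.clone _ _ *:%R _)
    (@GRing.scale R W : R -> W -> W).
  split=> [u'|u] c p q /=.
  - by rewrite scalerDl scalerA.
  - by rewrite scalerDr !scalerA mulrC.
pose bM := bilinear_isBilinear.Build R R W W _ _ (@GRing.scale R W) bil.
pose B : {bilinear R -> W -> W} := HB.pack (@GRing.scale R W : R -> W -> W) bM.
have cB : continuous (fun p : R * W => B p.1 p.2).
  by move=> p; exact: scale_continuous.
have dB := differentiable_bilin (a x, b x) cB.
have dp := differentiable_pair da db.
have -> : (fun y => a y *: b y) = (fun p => B p.1 p.2) \o (fun y => (a y, b y)).
  by [].
split; first exact: differentiable_comp.
by rewrite diff_comp // diff_bilin // diff_pair.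
Qed.

Lemma diff_idE V (x v : V) : 'd id x v = v.
Proof. by rewrite diff_val. Qed.

Lemma diff_compE V W X (f : V -> W) (g : W -> X) (x v : V) :
  differentiable f x -> differentiable g (f x) ->
  'd (g \o f) x v = 'd g (f x) ('d f x v).
Proof. by move=> df dg; rewrite diff_comp. Qed.

End Differentials.

(** * Stability of the classes C^k under the usual operations *)

Section CkCalculus.
Variable R : realType.
Implicit Types V W X : normedModType R.

Lemma Ck_sub V W k (O O' : set V) (f : V -> W) :
  O' `<=` O -> Ck k O f -> Ck k O' f.
Proof.
move=> sO; elim: k f => [|k IH] f /=; first by move=> H x /sO; exact: H.
by move=> [H1 H2]; split=> [x /sO|v]; [exact: H1|exact: IH].
Qed.

(** Since [O] is open, agreement on [O] is agreement of germs at each of its points, so it passes to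
    the directional differentials and the induction goes through. *)
Lemma Ck_eq V W k (O : set V) (f g : V -> W) :
  open O -> (forall x, O x -> f x = g x) -> Ck k O f -> Ck k O g.
Proof.
move=> oO; elim: k f g => [|k IH] f g fg /=.
  move=> cf x Ox; rewrite /prop_for /continuous_at -(fg x Ox).
  apply: cvg_trans (cf x Ox); apply: near_eq_cvg.
  by near=> y; apply: fg; near: y; exact: open_nbhs_nbhs.
have E x : O x -> differentiable f x ->
    differentiable g x /\ 'd g x = 'd f x :> (V -> W).
  move=> Ox; apply: near_eq_differentiable.
  by near=> y; apply: fg; near: y; exact: open_nbhs_nbhs.
move=> [df cf]; split=> [x Ox|v]; first by have [] := E x Ox (df x Ox).
by apply: IH (cf v) => x Ox; have [_ ->] := E x Ox (df x Ox).
Unshelve. all: by end_near. Qed.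

Lemma Ck_pred V W k (O : set V) (f : V -> W) : Ck k.+1 O f -> Ck k O f.
Proof.
elim: k f => [|k IH] f [df cf].
  by move=> x Ox; exact/differentiable_continuous/df.
by split=> // v; exact/IH/cf.
Qed.

Lemma Ck_cst V W k (O : set V) (a : W) : open O -> Ck k O (cst a : V -> W).
Proof.
move=> oO; elim: k a => [|k IH] a /=; first by move=> x _; exact: cst_continuous.
split=> [x _|v]; first exact: differentiable_cst.
by apply: Ck_eq (IH 0) => // x _; rewrite diff_cst.
Qed.

Lemma Ck_add V W k (O : set V) (f g : V -> W) :
  open O -> Ck k O f -> Ck k O g -> Ck k O (fun x => f x + g x).
Proof.
move=> oO; elim: k f g => [|k IH] f g /=.
  by move=> cf cg x Ox; apply: continuousD; [exact: cf|exact: cg].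
move=> [df cf] [dg cg]; split=> [x Ox|v].
  by apply: differentiableD; [exact: df|exact: dg].
apply: Ck_eq (IH _ _ (cf v) (cg v)) => // x Ox.
by rewrite [in RHS](_ : (fun x => f x + g x) = f + g) // diffD //;
  [exact: df|exact: dg].
Qed.

Lemma Ck_sum V W k (O : set V) (I : finType) (f : I -> V -> W) :
  open O -> (forall i, Ck k O (f i)) -> Ck k O (fun x => \sum_i f i x).
Proof.
move=> oO Cf; suff H (s : seq I) : Ck k O (fun x => \sum_(i <- s) f i x).
  exact: H.
elim: s => [|i s IH].
  by apply: Ck_eq (Ck_cst k 0 oO) => // x _; rewrite big_nil.
by apply: Ck_eq (Ck_add oO (Cf i) IH) => // x _; rewrite big_cons.
Qed.

Lemma Ck_scale V W k (O : set V) (a : V -> R) (f : V -> W) :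
  open O -> Ck k O a -> Ck k O f -> Ck k O (fun x => a x *: f x).
Proof.
move=> oO; elim: k a f => [|k IH] a f.
  by move=> ca cf x Ox; apply: continuousZ; [exact: ca|exact: cf].
move=> Ca Cf; have [da ca] := Ca; have [df cf] := Cf.
split=> [x Ox|v]; first by have [] := diff_scale (da x Ox) (df x Ox).
apply: (@Ck_eq _ _ _ _ (fun x => a x *: 'd f x v + 'd a x v *: f x)) => //.
  by move=> x Ox; have [_ ->] := diff_scale (da x Ox) (df x Ox).
(* In each term of the product rule one factor is left undifferentiated, so its regularity has to be
   lowered by one order. *)
by apply: Ck_add => //; apply: IH;
  [exact: Ck_pred|exact: cf|exact: ca|exact: Ck_pred].
Qed.

Lemma Ck_linear V W k (O : set V) (L : {linear V -> W}) :
  open O -> continuous L -> Ck k O L.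
Proof.
move=> oO cL; case: k => [|k]; first by move=> x _; exact: cL.
split=> [x _|v]; first exact: linear_differentiable.
by apply: Ck_eq (Ck_cst k (L v) oO) => // x _; rewrite diff_lin.
Qed.

Lemma Ck_linear_comp V W X k (O : set V) (L : {linear W -> X}) (f : V -> W) :
  open O -> continuous L -> Ck k O f -> Ck k O (fun x => L (f x)).
Proof.
move=> oO cL; elim: k f => [|k IH] f.
  by move=> cf x Ox; apply: continuous_comp; [exact: cf|exact: cL].
move=> [df cf]; split=> [x Ox|v].
  by apply: differentiable_comp; [exact: df|exact: linear_differentiable].
apply: Ck_eq (IH _ (cf v)) => // x Ox.
rewrite (diff_comp (df x Ox)); last exact: linear_differentiable.
by rewrite diff_lin.
Qed.

Lemma Ck_pair V W X k (O : set V) (f : V -> W) (g : V -> X) :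
  open O -> Ck k O f -> Ck k O g -> Ck k O (fun x => (f x, g x)).
Proof.
move=> oO; elim: k f g => [|k IH] f g.
  by move=> cf cg x Ox; apply: cvg_pair; [exact: cf|exact: cg].
move=> [df cf] [dg cg]; split=> [x Ox|v].
  by apply: differentiable_pair; [exact: df|exact: dg].
apply: Ck_eq (IH _ _ (cf v) (cg v)) => // x Ox.
by rewrite diff_pair //; [exact: df|exact: dg].
Qed.

(** A spanning family with continuous linear coordinates is the form that the chain rule uses: a
    direction varying with the base point is expanded over the fixed directions [e i]. *)
Definition fin_dim V : Prop :=
  exists (I : finType) (e : I -> V) (c : I -> {linear V -> R}),
    (forall i, continuous (c i)) /\ forall x, x = \sum_i c i x *: e i.

(** In ['d g (f x) ('d f x v)] the direction moves with [x], whereas [Ck] controls ['d g] in fixed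
    directions only. Expanding ['d f x v] over [e i] gives a finite sum of products to which the
    induction hypothesis applies. *)
Lemma Ck_comp V W X k (O : set V) (O' : set W) (f : V -> W) (g : W -> X) :
  fin_dim W -> open O -> (forall x, O x -> O' (f x)) ->
  Ck k O f -> Ck k O' g -> Ck k O (g \o f).
Proof.
move=> [N [e [c [cc ce]]]] oO fO; elim: k g => [|k IH] g.
  move=> cf cg x Ox; apply: continuous_comp; first exact: cf.
  exact/cg/fO.
move=> Cf [dg cg]; have [df cf] := Cf; split=> [x Ox|v].
  by apply: differentiable_comp; [exact: df|exact/dg/fO].
apply: (@Ck_eq _ _ _ _
  (fun x => \sum_i c i ('d f x v) *: ((fun y => 'd g y (e i)) \o f) x)) => //.
  move=> x Ox; rewrite (diff_comp (df x Ox) (dg _ (fO x Ox))).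
  by rewrite /= [in RHS](ce ('d f x v)) linear_sum; apply: eq_bigr => i _;
    rewrite linearZ.
apply: Ck_sum => // i; apply: Ck_scale => //.
  by apply: Ck_linear_comp; [exact: oO|exact: cc|exact: cf].
by apply: IH; [exact: Ck_pred|exact: cg].
Qed.

Lemma coord_is_linear p q (i : 'I_p) (j : 'I_q) :
  linear (fun M : 'M[R]_(p, q) => M i j : R).
Proof. by move=> a M M'; rewrite !mxE. Qed.

Definition mx_coord p q (i : 'I_p) (j : 'I_q) : {linear 'M[R]_(p, q) -> R} :=
  HB.pack (fun M : 'M[R]_(p, q) => M i j : R)
    (GRing.isLinear.Build R 'M[R]_(p, q) R _ _ (coord_is_linear i j)).

Lemma mx_coord_continuous p q (i : 'I_p) (j : 'I_q) :
  continuous (@mx_coord p q i j).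
Proof. exact: coord_continuous. Qed.

Lemma fin_dim_matrix p q : fin_dim 'M[R]_(p, q).
Proof.
exists ('I_p * 'I_q)%type, (fun u => delta_mx u.1 u.2),
  (fun u => mx_coord u.1 u.2).
split=> [u|M]; first exact: mx_coord_continuous.
by rewrite [LHS]matrix_sum_delta pair_big.
Qed.

Lemma fin_dim_prod V W : fin_dim V -> fin_dim W -> fin_dim (V * W)%type.
Proof.
move=> [N [e [c [cc ce]]]] [N' [e' [c' [cc' ce']]]].
have lin1 (i : N) : linear (fun z : V * W => c i z.1 : R).
  by move=> a z z'; rewrite linearP.
have lin2 (i : N') : linear (fun z : V * W => c' i z.2 : R).
  by move=> a z z'; rewrite linearP.
pose d1 i : {linear (V * W)%type -> R} := HB.pack (fun z : V * W => c i z.1 : R)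
  (GRing.isLinear.Build R (V * W)%type R _ _ (lin1 i)).
pose d2 i : {linear (V * W)%type -> R} := HB.pack (fun z : V * W => c' i z.2 : R)
  (GRing.isLinear.Build R (V * W)%type R _ _ (lin2 i)).
exists (N + N')%type,
  (fun k => match k with inl i => (e i, 0) | inr j => (0, e' j) end),
  (fun k => match k with inl i => d1 i | inr j => d2 j end); split.
  case=> i z /=.
    by apply: continuous_comp; [exact: cvg_fst|exact: cc].
  by apply: continuous_comp; [exact: cvg_snd|exact: cc'].
move=> z; rewrite big_sumType /=.
have fstS (I : finType) (F : I -> (V * W)%type) : (\sum_i F i).1 = \sum_i (F i).1.
  exact: (big_morph fst).
have sndS (I : finType) (F : I -> (V * W)%type) : (\sum_i F i).2 = \sum_i (F i).2.
  exact: (big_morph snd).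
apply: injective_projections; rewrite /= ?fstS ?sndS /=.
  rewrite [X in _ + X]big1 => [|i _]; last by rewrite scaler0.
  by rewrite addr0 -ce.
rewrite [X in X + _]big1 => [|i _]; last by rewrite scaler0.
by rewrite add0r -ce'.
Qed.

End CkCalculus.

(** * Smoothness at a point *)

Section SmoothAt.
Variable R : realType.
Implicit Types V W X : normedModType R.

Definition smooth_at V W (f : V -> W) (x : V) : Prop :=
  exists2 O : set V, open_nbhs x O & forall k, Ck k O f.

Lemma smooth_at_eq V W (f g : V -> W) (x : V) :
  (\forall y \near x, f y = g y) -> smooth_at f x -> smooth_at g x.
Proof.
move=> /near_open_nbhs[ O' [oO' O'x] fg] [ O [oO Ox] CO].
exists (O `&` O'); first by split; [exact: openI|].
move=> k; apply: (@Ck_eq _ _ _ _ _ f); first exact: openI.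
  by move=> y [_ /fg].
by apply: Ck_sub (CO k) => y [].
Qed.

Lemma smooth_at_near V W (f : V -> W) (x : V) :
  smooth_at f x -> \forall y \near x, smooth_at f y.
Proof.
move=> [ O [oO Ox] CO]; near=> y; exists O => //; split=> //.
near: y; exact: open_nbhs_nbhs.
Unshelve. all: by end_near. Qed.

Lemma smooth_at_diff V W (f : V -> W) (x : V) :
  smooth_at f x -> differentiable f x.
Proof. by move=> [ O [oO Ox] /(_ 1%N)[df _]]; exact: df. Qed.

Lemma smooth_at_continuous V W (f : V -> W) (x : V) :
  smooth_at f x -> {for x, continuous f}.
Proof. by move=> /smooth_at_diff; exact: differentiable_continuous. Qed.

Lemma smooth_at_diff_dir V W (f : V -> W) (x v : V) :
  smooth_at f x -> smooth_at (fun y => 'd f y v) x.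
Proof. by move=> [ O xO CO]; exists O => // k; have [_] := CO k.+1; apply. Qed.

Lemma smooth_at_linear V W (L : {linear V -> W}) (x : V) :
  continuous L -> smooth_at L x.
Proof.
by move=> cL; exists setT => [|k]; [split=> //; exact: openT|
  apply: Ck_linear => //; exact: openT].
Qed.

Lemma smooth_at_cst V W (a : W) (x : V) : smooth_at (fun=> a) x.
Proof.
by exists setT => [|k]; [split=> //; exact: openT|apply: Ck_cst; exact: openT].
Qed.

Lemma smooth_at_id V (x : V) : smooth_at id x.
Proof. by apply: (@smooth_at_linear V V idfun) => y; exact: cvg_id. Qed.

Lemma smooth_at_pair V W X (f : V -> W) (g : V -> X) (x : V) :
  smooth_at f x -> smooth_at g x -> smooth_at (fun y => (f y, g y)) x.
Proof.
move=> [ O [oO Ox] CO] [ O' [oO' Ox'] CO'].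
have oOO := openI oO oO'; exists (O `&` O') => // k.
by apply: Ck_pair => //; [apply: Ck_sub (CO k)|apply: Ck_sub (CO' k)] => y [].
Qed.

(** Near [x] the values of [f] lie in [S], where [g] coincides with a smooth extension [F]; hence
    [g \o f] has the germ of [F \o f], even if [g] itself is not differentiable. *)
Lemma smooth_on_comp V W X (S : set W) (f : V -> W) (g : W -> X) (x : V) :
  fin_dim W -> smooth_at f x -> smooth_on S g ->
  (\forall y \near x, S (f y)) -> smooth_at (g \o f) x.
Proof.
move=> fW sf sg fS; have [ O [oO Ox] CO] := sf.
have [ O' [F [oO' O'x CF FE]]] := sg _ (nbhs_singleton fS).
have fO' : \forall y \near x, O' (f y).
  by apply: (smooth_at_continuous sf); exact: open_nbhs_nbhs.
have : \forall y \near x, [/\ O y, O' (f y) & S (f y)].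
  near=> y; split; near: y => //; exact: open_nbhs_nbhs.
move=> /near_open_nbhs[ O1 [oO1 O1x] H]; exists O1 => // k.
apply: (@Ck_eq _ _ _ _ _ (F \o f)) => // [y /H[_ O'y Sy]|].
  exact: FE.
apply: (@Ck_comp _ _ _ _ _ _ O') => // [y /H[]//|].
by apply: Ck_sub (CO k) => y /H[].
Unshelve. all: by end_near. Qed.

Lemma smooth_at_on V W (f : V -> W) (O : set V) :
  open O -> (forall x, O x -> smooth_at f x) -> smooth_on O f.
Proof.
by move=> oO H x /H[ O' [oO' O'x] CO']; exists O', f.
Qed.

Lemma smooth_onT V W (f : V -> W) (x : V) : smooth_on setT f -> smooth_at f x.
Proof.
move=> /(_ x I)[ O [F [oO Ox CO FE]]].
apply: (@smooth_at_eq _ _ F); last by exists O.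
by near=> y; apply: FE => //; near: y; exact: open_nbhs_nbhs.
Unshelve. all: by end_near. Qed.

Lemma smooth_at_comp V W X (f : V -> W) (g : W -> X) (x : V) :
  fin_dim W -> smooth_at f x -> smooth_at g (f x) -> smooth_at (g \o f) x.
Proof.
move=> fW sf [ O [oO Ox] CO].
apply: (@smooth_on_comp _ _ _ O) => //.
  by apply: smooth_at_on => // y Oy; exists O.
by apply: (smooth_at_continuous sf); exact: open_nbhs_nbhs.
Qed.

Lemma smooth_at_line V (v : V) (t : R) : smooth_at (fun t : R => t *: v) t.
Proof.
exists setT => [|k]; first by split=> //; exact: openT.
have oT : open [set: R] by exact: openT.
apply: Ck_scale; [exact: oT| |exact: Ck_cst].
by apply: (@Ck_linear _ _ _ _ _ idfun) => // x; exact: cvg_id.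
Qed.

Lemma smooth_at_fst V W (z : V * W) : smooth_at fst z.
Proof. by apply: (@smooth_at_linear _ _ fst) => x; exact: cvg_fst. Qed.

Lemma smooth_at_snd V W (z : V * W) : smooth_at snd z.
Proof. by apply: (@smooth_at_linear _ _ snd) => x; exact: cvg_snd. Qed.

Lemma near_eq_diff V W (f g : V -> W) (x v : V) :
  (\forall y \near x, f y = g y) -> smooth_at f x -> 'd f x v = 'd g x v.
Proof.
by move=> fg /smooth_at_diff df; have [_ ->] := near_eq_differentiable fg df.
Qed.

(** Equality near [x] is also equality near every point close to [x], so the first differentials
    agree as germs and can be differentiated again. *)
Lemma near_eq_diff_dir V W (f g : V -> W) (x a : V) :
  (\forall y \near x, f y = g y) -> smooth_at f x ->
  \forall y \near x, 'd f y a = 'd g y a.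
Proof.
move=> /near_join fg /smooth_at_near sf.
by apply: filterS2 fg sf => y fgy sfy; exact: near_eq_diff.
Qed.

(** * Lipschitz and Taylor estimates, symmetry of second derivatives *)

Lemma differentiable_lipschitz V W (f : V -> W) (x : V) : differentiable f x ->
  exists2 C, 0 < C & \forall y \near x, `|f y - f x| <= C * `|y - x|.
Proof.
move=> df; have [k k0 Hk] := linear_lipschitz (diff_continuous df).
have /eqaddoP/(_ 1 ltr01) := diff_locally df.
(* [k] bounds the linear part, and [1] is the little-o tolerance chosen above. *)
move=> H; exists (1 + k); first by rewrite addr_gt0.
rewrite (near_shift 0) /= subr0; apply: filterS H => h; rewrite !fctE /= => H.
have -> : f (h + x) - f x = (f (h + x) - (f x + 'd f x h)) + 'd f x h.
  by rewrite opprD addrA subrK.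
by rewrite addrK (le_trans (ler_normD _ _)) // mulrDl lerD.
Qed.

Lemma lipschitz_continuous_at V W (f : V -> W) (x : V)
    (C : R) :
  0 < C -> (\forall y \near x, `|f y - f x| <= C * `|y - x|) ->
  {for x, continuous f}.
Proof.
move=> C0 Hf; apply/cvgrPdist_le => e e0; near=> y; rewrite distrC.
apply: (@le_trans _ _ (C * `|y - x|)); first by near: y.
rewrite -ler_pdivlMl //; near: y; apply/nbhs_ballP.
exists (C^-1 * e); first by rewrite /= mulr_gt0 // invr_gt0.
by move=> y; rewrite -ball_normE /= distrC => /ltW.
Unshelve. all: by end_near. Qed.

Lemma is_derive_line V W (a : V -> W) (p v : V) (s : R) :
  differentiable a (p + s *: v) ->
  is_derive s (1 : R) (fun s : R => a (p + s *: v)) ('d a (p + s *: v) v).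
Proof.
move=> da.
have dl : is_diff s (fun s : R => p + s *: v) ( *:%R^~ v).
  have -> : (fun s : R => p + s *: v) = cst p + ( *:%R^~ v) by [].
  by apply: is_diff_eq; rewrite add0r.
have d : differentiable (a \o (fun s : R => p + s *: v)) s.
  by apply: differentiable_comp; [exact: ex_diff|].
apply: DeriveDef; first exact: diff_derivable.
by rewrite deriveE // diff_comp // diff_val /= scale1r.
Qed.

Lemma MVT_line V (a : V -> R) (p v : V) (t : R) : 0 < t ->
  (forall s, 0 <= s <= t -> differentiable a (p + s *: v)) ->
  exists2 s, 0 < s < t & a (p + t *: v) - a p = 'd a (p + s *: v) v * t.
Proof.
move=> t0 da.
have D s : 0 <= s <= t -> is_derive s (1 : R) (fun s : R => a (p + s *: v))
    ('d a (p + s *: v) v).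
  by move=> s0t; apply: is_derive_line; exact: da.
have [||s] := @MVT R (fun s => a (p + s *: v))
  (fun s => 'd a (p + s *: v) v) 0 t t0.
- by move=> x; rewrite in_itv /= => /andP[x0 xt]; apply: D; rewrite !ltW.
- apply: derivable_within_continuous => x; rewrite in_itv /= => x0t.
  by have [] := D x x0t.
rewrite in_itv /= => s0t; rewrite scale0r addr0 subr0 => E.
by exists s.
Qed.

(** The mean value theorem on the segment from [0] to [y] gives [a y - a 0 = 'd a (s *: y) y] with
    [s] between 0 and 1. Each ['d a z (e i)] is Lipschitz at [0], and the coordinates of [y] supply
    the second factor [|y|]. *)
Lemma taylor2 V (a : V -> R) : fin_dim V -> smooth_at a 0 ->
  exists2 C, 0 < C &
    \forall y \near (0 : V), `|a y - a 0 - 'd a 0 y| <= C * `|y| ^+ 2.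
Proof.
move=> [I [e [c [cc ce]]]] sa.
have /choice[K HK] i : exists K, 0 < K /\ forall y, `|c i y| <= K * `|y|.
  by have [K K0 HK] := linear_lipschitz (cc i); exists K.
have /choice[L HL] i : exists L, 0 < L /\ \forall y \near (0 : V),
    `|'d a y (e i) - 'd a 0 (e i)| <= L * `|y|.
  have [L L0 HL] := differentiable_lipschitz
    (smooth_at_diff (smooth_at_diff_dir (e i) sa)).
  by exists L; split=> //; apply: filterS HL => y; rewrite subr0.
have HL' : \forall y \near (0 : V), forall i,
    `|'d a y (e i) - 'd a 0 (e i)| <= L i * `|y|.
  by apply: filter_forall => i; have [] := HL i.
have : \forall y \near (0 : V), differentiable a y /\ forall i,
    `|'d a y (e i) - 'd a 0 (e i)| <= L i * `|y|.
  apply: filterS2 (smooth_at_near sa) HL' => y sy Hy; split=> //.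
  exact: smooth_at_diff.
move=> /nbhs_ballP[r /= r0 Hr].
exists (1 + \sum_i K i * L i).
  rewrite ltr_pwDl // sumr_ge0 // => i _.
  by rewrite mulr_ge0 // ltW //; [case: (HK i)|case: (HL i)].
apply/nbhs_ballP; exists r => //= y; rewrite -ball_normE /= sub0r normrN => yr.
have ysr s : 0 <= s <= 1 -> ball (0 : V) r (0 + s *: y).
  move=> /andP[s0 s1]; rewrite -ball_normE /= sub0r normrN add0r normrZ.
  by rewrite ger0_norm // (le_lt_trans _ yr) // ler_piMl.
have [s /ysr/Hr[]//|s /andP[s0 s1]] := @MVT_line _ a 0 y 1 ltr01.
have s01 : 0 <= s <= 1 by rewrite !ltW.
have [_ Hs] := Hr _ (ysr s s01).
rewrite !add0r scale1r mulr1 => ->; rewrite add0r in Hs.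
have E z : 'd a z y = \sum_i c i y * 'd a z (e i).
  by rewrite {1}(ce y) linear_sum; apply: eq_bigr => i _; rewrite linearZ.
rewrite !E -sumrB.
apply: (le_trans (ler_norm_sum _ _ _)).
rewrite mulrDl; apply: ler_wpDl; first by rewrite mul1r exprn_ge0.
rewrite mulr_suml ler_sum // => i _; rewrite -mulrBr normrM.
have [Ki HKi] := HK i; have [Li HLi] := HL i.
rewrite expr2 mulrACA; apply: ler_pM => //; apply: (le_trans (Hs i)).
by rewrite ler_pM2l // normrZ gtr0_norm // ler_piMl // ltW.
Qed.

(** The left side is the increment from [0] to [t *: u] of [p x = a (x + t *: w) - a x]. The mean
    value theorem in direction [u] turns it into a difference of two values of [b = 'd a _ u], and
    each value is expanded to first order at [0]. *)
Lemma second_difference V (a : V -> R) (u w : V) : fin_dim V -> smooth_at a 0 ->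
  exists2 C, 0 < C & \forall t \near (0 : R)^'+,
    `|a (t *: u + t *: w) - a (t *: u) - a (t *: w) + a 0
      - t ^+ 2 * 'd (fun y => 'd a y u) 0 w| <= C * t ^+ 3.
Proof.
move=> fV sa; pose b y := 'd a y u.
have sb : smooth_at b 0 by exact: smooth_at_diff_dir.
have [C C0 HC] := taylor2 fV sb.
have : \forall y \near (0 : V), differentiable a y /\
   `|b y - b 0 - 'd b 0 y| <= C * `|y| ^+ 2.
  by apply: filterS2 (smooth_at_near sa) HC => y sy Hy; split=> //;
    exact: smooth_at_diff.
move=> /nbhs_ballP[r /= r0 Hr].
(* All points [s *: u + s' *: w] with [s, s'] in [[0, t]] have norm at most [t * N]; the [1] keeps
   [N] positive when [u] and [w] vanish. *)
pose N := 1 + `|u| + `|w|.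
have N0 : 0 < N by rewrite /N -addrA ltr_pwDl // addr_ge0.
have small t s s' : 0 < t -> 0 <= s <= t -> 0 <= s' <= t ->
    `|s *: u + s' *: w| <= t * N.
  move=> t0 /andP[s0 st] /andP[s'0 s't]; rewrite (le_trans (ler_normD _ _)) //.
  rewrite !normrZ !ger0_norm // /N !mulrDr -addrA.
  apply: ler_wpDl; first by rewrite mulr1 ltW.
  by rewrite lerD // ler_wpM2r.
exists (C * N ^+ 2 *+ 2); first by rewrite pmulrn_lgt0 // mulr_gt0 // exprn_gt0.
near=> t.
have t0 : 0 < t by near: t; exact: nbhs_right_gt.
have tr : t * N < r.
  rewrite -ltr_pdivlMr //; near: t; apply: nbhs_right_lt; exact: divr_gt0.
have inball s s' : 0 <= s <= t -> 0 <= s' <= t ->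
    ball (0 : V) r (s *: u + s' *: w).
  move=> hs hs'; rewrite -ball_normE /= sub0r normrN.
  by rewrite (le_lt_trans _ tr) // small.
have tt : 0 <= t <= t by rewrite lexx ltW.
have zt : 0 <= (0 : R) <= t by rewrite lexx ltW.
pose p (x : V) := a (x + t *: w) - a x.
have dsh x : differentiable a (x + t *: w) ->
    is_diff x (fun x => a (x + t *: w)) ('d a (x + t *: w)).
  move=> dax.
  have -> : (fun x => a (x + t *: w)) = a \o (fun x => x + t *: w) by [].
  have dl : is_diff x (fun x => x + t *: w) id.
    have -> : (fun x : V => x + t *: w) = id + cst (t *: w) by [].
    by apply: is_diff_eq; rewrite addr0.
  have da : is_diff (x + t *: w) a ('d a (x + t *: w)) by exact: differentiableP.
  by apply: is_diff_eq.
have dp s : 0 <= s <= t -> is_diff (s *: u) p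
    (fun v => 'd a (s *: u + t *: w) v - 'd a (s *: u) v).
  move=> hs; have [d1 _] := Hr _ (inball s t hs tt).
  have [+ _] := Hr _ (inball s 0 hs zt).
  rewrite scale0r addr0 => /differentiableP d2.
  have d3 := dsh _ d1.
  have -> : p = (fun x => a (x + t *: w)) - a by [].
  exact: is_diff_eq.
have [s hs|s /andP[s0 st]] := @MVT_line _ p 0 u t t0.
  by rewrite add0r; have [] := dp s hs.
have hs : 0 <= s <= t by rewrite !ltW.
rewrite !add0r; have [_ ->] := dp s hs; rewrite /p /= add0r => E.
have [_ B1] := Hr _ (inball s t hs tt); have [_] := Hr _ (inball s 0 hs zt).
rewrite scale0r addr0 => B2.
have -> : a (t *: u + t *: w) - a (t *: u) - a (t *: w) + a 0 =
  a (t *: u + t *: w) - a (t *: u) - (a (t *: w) - a 0).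
  by rewrite opprB addrA addrAC.
rewrite E -/(b _) -/(b _).
(* The contributions of the unknown [s] to the linear terms cancel, leaving [t * 'd b 0 w]. *)
have -> : (b (s *: u + t *: w) - b (s *: u)) * t - t ^+ 2 * 'd b 0 w =
  t * ((b (s *: u + t *: w) - b 0 - 'd b 0 (s *: u + t *: w))
       - (b (s *: u) - b 0 - 'd b 0 (s *: u))).
  have lin (k : R) x : 'd b 0 (k *: x) = k * 'd b 0 x by rewrite linearZ.
  by rewrite linearD !lin; ring.
have bnd (z : V) : `|z| <= t * N -> C * `|z| ^+ 2 <= C * N ^+ 2 * t ^+ 2.
  move=> zN; rewrite -mulrA -exprMn ler_pM2l // [N * t]mulrC ler_sqr ?nnegrE //.
  by rewrite mulr_ge0 // ltW.
have -> : C * N ^+ 2 *+ 2 * t ^+ 3 =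
  t * (C * N ^+ 2 * t ^+ 2 + C * N ^+ 2 * t ^+ 2) by ring.
rewrite normrM gtr0_norm // ler_pM2l //; apply: (le_trans (ler_normB _ _)).
apply: lerD; [apply: (le_trans B1)|apply: (le_trans B2)]; apply: bnd.
  exact: small.
by have := small t s 0 t0 hs zt; rewrite scale0r addr0.
Unshelve. all: by end_near. Qed.

(** Schwarz's theorem: the second difference is symmetric in [u] and [w], so after division by
    [t ^+ 2] both mixed derivatives are within [O(t)] of the same number, for every small
    [t > 0]. *)
Lemma diff_diff_sym V (a : V -> R) (u w : V) : fin_dim V -> smooth_at a 0 ->
  'd (fun y => 'd a y u) 0 w = 'd (fun y => 'd a y w) 0 u.
Proof.
move=> fV sa; have [C C0 HC] := second_difference u w fV sa.
have [C' C'0 HC'] := second_difference w u fV sa.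
set X := 'd _ 0 w; set Y := 'd _ 0 u.
apply/eqP; rewrite -subr_eq0 -normr_le0; apply/ler_addgt0Pl => e e0.
rewrite addr0.
have : \forall t \near (0 : R)^'+, `|X - Y| <= (C + C') * t.
  near=> t.
  have t0 : 0 < t by near: t; exact: nbhs_right_gt.
  have H : `|a (t *: u + t *: w) - a (t *: u) - a (t *: w) + a 0 - t ^+ 2 * X|
      <= C * t ^+ 3 by near: t.
  have : `|a (t *: w + t *: u) - a (t *: w) - a (t *: u) + a 0 - t ^+ 2 * Y|
      <= C' * t ^+ 3 by near: t.
  rewrite [t *: w + _]addrC => H'.
  rewrite -(ler_pM2l (exprn_gt0 2 t0)) mulrCA -exprSr mulrDl.
  have -> : t ^+ 2 * `|X - Y| = `|t ^+ 2 * (X - Y)|.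
    by rewrite normrM ger0_norm // exprn_ge0 // ltW.
  have -> : t ^+ 2 * (X - Y) =
      (a (t *: u + t *: w) - a (t *: w) - a (t *: u) + a 0 - t ^+ 2 * Y) -
      (a (t *: u + t *: w) - a (t *: u) - a (t *: w) + a 0 - t ^+ 2 * X) by ring.
  by apply: (le_trans (ler_normB _ _)); rewrite addrC lerD.
move=> H; have : \forall t \near (0 : R)^'+, `|X - Y| <= e.
  near=> t; apply: (@le_trans _ _ ((C + C') * t)); first by near: t.
  rewrite -ler_pdivlMl ?addr_gt0 //; near: t; apply: nbhs_right_le.
  by rewrite mulr_gt0 // invr_gt0 addr_gt0.
by move=> /filter_ex[].
Unshelve. all: by end_near. Qed.

(** * Matrix-valued maps, entry by entry *)

Lemma mx_norm_le p q (M : 'M[R]_(p, q)) (C : R) :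
  0 <= C -> (forall i j, `|M i j| <= C) -> `|M| <= C.
Proof.
move=> C0 H; rewrite /Num.Def.normr /= mx_normrE.
by apply: bigmax_le => // -[i j] _; exact: H.
Qed.

Lemma le_mx_norm p q (M : 'M[R]_(p, q)) i j : `|M i j| <= `|M|.
Proof.
rewrite [leRHS]/Num.Def.normr /= mx_normrE.
exact: (le_bigmax _ (fun ij => `|M ij.1 ij.2|) (i, j)).
Qed.

Lemma sub_mxE p q (A B : 'M[R]_(p, q)) i j : (A - B) i j = A i j - B i j.
Proof. by rewrite !mxE. Qed.

Lemma diff_coord V p q (f : V -> 'M[R]_(p, q)) (x v : V) i j :
  differentiable f x -> 'd (fun y => f y i j) x v = 'd f x v i j.
Proof.
move=> df; have cc := @mx_coord_continuous R p q i j.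
have dc := linear_differentiable (f x) cc.
by apply: (etrans (diff_compE v df dc)); rewrite diff_lin.
Qed.

Lemma smooth_at_coord V p q (f : V -> 'M[R]_(p, q)) (x : V) i j :
  smooth_at f x -> smooth_at (fun y => f y i j) x.
Proof.
move=> [ O [oO Ox] CO]; exists O => // k.
exact: (Ck_linear_comp oO (@mx_coord_continuous _ _ _ i j) (CO k)).
Qed.

(** The mean value argument is for real values, so it is applied to each entry and the finitely many
    constants are merged. *)
Lemma taylor2_mx V p q (f : V -> 'M[R]_(p, q)) : fin_dim V -> smooth_at f 0 ->
  exists2 C, 0 < C &
    \forall y \near (0 : V), `|f y - f 0 - 'd f 0 y| <= C * `|y| ^+ 2.
Proof.
move=> fV sf.
have [||C C0 HC] := @near_le_finite R _ _ (nbhs_filter (0 : V)) ('I_p * 'I_q)%type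
  (fun u y => `|f y u.1 u.2 - f 0 u.1 u.2 - 'd f 0 y u.1 u.2|)
  (fun y => `|y| ^+ 2).
- by move=> y; exact: exprn_ge0.
- move=> u; have [C C0 HC] := taylor2 fV (smooth_at_coord u.1 u.2 sf).
  exists C => //; apply: filterS HC => y.
  by rewrite (diff_coord y u.1 u.2 (smooth_at_diff sf)).
exists C => //; apply: filterS HC => y Hy; apply: mx_norm_le.
  by rewrite mulr_ge0 ?exprn_ge0 // ltW.
by move=> i j; rewrite !sub_mxE; exact: (Hy (i, j)).
Qed.

End SmoothAt.

(** * Stability of invertibility under perturbation *)

Section UnitMatrices.
Variable R : realType.

Lemma mulmx_norm p d (M : 'M[R]_(p, d)) (x : 'cV[R]_d) :
  `|M *m x| <= d%:R * `|M| * `|x|.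
Proof.
apply: mx_norm_le => [|i j]; first by rewrite !mulr_ge0.
rewrite mxE; apply: (le_trans (ler_norm_sum _ _ _)).
apply: (@le_trans _ _ (\sum_(k < d) `|M| * `|x|)).
  by apply: ler_sum => k _; rewrite normrM ler_pM // le_mx_norm.
by rewrite sumr_const card_ord -mulrA mulr_natl.
Qed.

Lemma unitmx_ker d (M : 'M[R]_d) :
  (forall x : 'cV[R]_d, M *m x = 0 -> x = 0) -> M \in unitmx.
Proof.
move=> H; rewrite -unitmx_tr -row_free_unit; apply: inj_row_free => v Hv.
by apply: trmx_inj; rewrite trmx0; apply: H; rewrite -[M]trmxK -trmx_mul Hv trmx0.
Qed.

(** Write [x] as [invmx A0] applied to [A *m x - (A - A0) *m x]. For [A] close to [A0] the second
    part has norm at most half of [|x|] and is absorbed. The resulting bound makes the kernel of [A]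
    trivial, hence [A] invertible. *)
Lemma unitmx_bounded_below d (A0 : 'M[R]_d) : A0 \in unitmx ->
  exists2 C : R, 0 < C & \forall A \near A0,
    A \in unitmx /\ forall x : 'cV[R]_d, `|x| <= C * `|A *m x|.
Proof.
move=> uA0; set b : R := d%:R * `|invmx A0|.
have b0 : 0 <= b by rewrite mulr_ge0.
(* Absorbing half of [|x|] doubles [b]; the [1] ensures positivity. *)
exists (2 * b + 1); first by rewrite ltr_wpDl // mulr_ge0.
(* Chosen so that [b * d%:R * r] is at most one half. *)
pose r : R := (2 * (b * d%:R + 1))^-1.
have bd0 : 0 < b * d%:R + 1 by rewrite ltr_wpDl // mulr_ge0.
have r0 : 0 < r by rewrite invr_gt0 mulr_gt0.
apply/nbhs_ballP; exists r => //= A; rewrite -ball_normE /= distrC => Ar.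
suff H (x : 'cV[R]_d) : `|x| <= (2 * b + 1) * `|A *m x|.
  split=> //; apply: unitmx_ker => x Ax0; apply/eqP; rewrite -normr_le0.
  by have := H x; rewrite Ax0 normr0 mulr0.
have E : x = invmx A0 *m (A *m x) - invmx A0 *m ((A - A0) *m x).
  by rewrite -mulmxBr -mulmxBl opprB addrC subrK mulmxA mulVmx // mul1mx.
have H1 : `|x| <= b * `|A *m x| + b * (d%:R * `|A - A0| * `|x|).
  rewrite {1}E; apply: (le_trans (ler_normB _ _)); apply: lerD.
    exact: mulmx_norm.
  apply: (le_trans (mulmx_norm _ _)); rewrite ler_wpM2l //; exact: mulmx_norm.
have H2 : b * (d%:R * `|A - A0| * `|x|) <= 2^-1 * `|x|.
  rewrite !mulrA ler_wpM2r //.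
  apply: (@le_trans _ _ ((b * d%:R + 1) * r)); last first.
    by rewrite /r invfM mulrCA mulfV ?mulr1 // gt_eqF.
  by apply: ler_pM => //; [exact: mulr_ge0|rewrite lerDl|exact: ltW].
have n0 : 0 <= `|A *m x| by [].
move: H1 H2 n0; set u := `|x|; set v := `|A *m x|; set w := b * (_ * _); lra.
Qed.

End UnitMatrices.

(** * Partial differentials of functions of two variables *)

Section Slices.
Variable R : realType.
Implicit Types V W X : normedModType R.

Lemma is_diff_bigsum V W (I : Type) (s : seq I) (f : I -> V -> W)
    (df : I -> V -> W) (x : V) :
  (forall i, is_diff x (f i) (df i)) ->
  is_diff x (fun y => \sum_(i <- s) f i y) (fun v => \sum_(i <- s) df i v).
Proof.
move=> H; elim: s => [|i s IH].
  have -> : (fun y => \sum_(i <- [::]) f i y) = cst 0.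
    by apply/funext => y; rewrite big_nil.
  by apply: is_diff_eq; apply/funext => y; rewrite big_nil.
have -> : (fun y => \sum_(i <- i :: s) f i y) =
    f i + (fun y => \sum_(i <- s) f i y).
  by apply/funext => y; rewrite big_cons.
by apply: is_diff_eq; apply/funext => y; rewrite big_cons.
Qed.

Lemma is_diff_slicer V W X (q : V * W -> X) (y : V) (x : W) :
  differentiable q (y, x) ->
  is_diff x (fun x => q (y, x)) (fun v => 'd q (y, x) (0, v)).
Proof.
move=> dq; have -> : (fun x => q (y, x)) = q \o (fun x => (cst y x, id x)) by [].
have dq' : is_diff (cst y x, id x) q ('d q (y, x)) by exact: differentiableP.
exact: is_diff_eq.
Qed.

Lemma is_diff_slicel V W X (q : V * W -> X) (y : V) (x : W) :
  differentiable q (y, x) ->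
  is_diff y (fun y => q (y, x)) (fun v => 'd q (y, x) (v, 0)).
Proof.
move=> dq; have -> : (fun y => q (y, x)) = q \o (fun y => (id y, cst x y)) by [].
have dq' : is_diff (id y, cst x y) q ('d q (y, x)) by exact: differentiableP.
exact: is_diff_eq.
Qed.

Lemma diff_slicel V W X (q : V * W -> X) y x v :
  differentiable q (y, x) -> 'd q (y, x) (v, 0) = 'd (fun y => q (y, x)) y v.
Proof. by move=> /is_diff_slicel D; rewrite [in RHS]diff_val. Qed.

Lemma diff_slicer V W X (q : V * W -> X) y x v :
  differentiable q (y, x) -> 'd q (y, x) (0, v) = 'd (fun x => q (y, x)) x v.
Proof. by move=> /is_diff_slicer D; rewrite [in RHS]diff_val. Qed.

Lemma smooth_at_slicer V W X (q : V * W -> X) (y : V) (x : W) :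
  fin_dim V -> fin_dim W ->
  smooth_at q (y, x) -> smooth_at (fun x => q (y, x)) x.
Proof.
move=> fV fW sq; apply: (@smooth_at_comp _ _ _ _ (fun x => (y, x)) q) => //.
  exact: fin_dim_prod.
by apply: smooth_at_pair; [exact: smooth_at_cst|exact: smooth_at_id].
Qed.

Lemma grad_slicer V d (q : V * 'cV[R]_d -> R) y x i :
  differentiable q (y, x) ->
  grad (fun x => q (y, x)) x i 0 = 'd q (y, x) (0, delta_mx i 0).
Proof.
move=> /is_diff_slicer D; have := @ex_diff _ _ _ _ _ _ _ D => dq.
by rewrite mxE deriveE // diff_val.
Qed.

Lemma hessE d (h : 'cV[R]_d -> R) x i j : smooth_at h x ->
  hess h x i j = 'd (fun y => 'd h y (delta_mx j 0)) x (delta_mx i 0).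
Proof.
move=> sh; rewrite mxE.
rewrite (@near_eq_derive _ _ _ _ (fun y => 'd h y (delta_mx j 0))).
  by rewrite deriveE //; exact/smooth_at_diff/smooth_at_diff_dir.
by apply: filterS (smooth_at_near sh) => y /smooth_at_diff dh; rewrite deriveE.
Qed.

(** This reads the Hessians of all slices off a single function of [(y, x)], so that their
    dependence on [y] can be estimated by differentiating in both variables. *)
Lemma hess_slicer V d (q : V * 'cV[R]_d -> R) y x i j :
  fin_dim V -> smooth_at q (y, x) ->
  hess (fun x => q (y, x)) x i j =
    'd (fun z => 'd q z (0, delta_mx j 0)) (y, x) (0, delta_mx i 0).
Proof.
move=> fV sq; have fd := @fin_dim_matrix R d 1.
rewrite hessE; last exact: smooth_at_slicer.
have sq' := smooth_at_diff_dir (0, delta_mx j 0) sq.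
have D := is_diff_slicer (smooth_at_diff sq').
rewrite -(congr1 (@^~ (delta_mx i 0)) (@diff_val _ _ _ _ _ _ _ D)) /=.
have [|_ ->//] := @near_eq_differentiable _ _ _ _
  (fun x' => 'd (fun x => q (y, x)) x' (delta_mx j 0)) _ _
  (@ex_diff _ _ _ _ _ _ _ D).
have : \forall x' \near x, smooth_at q (y, x').
  have c : {for x, continuous (fun x => (y, x))}.
    apply/smooth_at_continuous/smooth_at_pair; last exact: smooth_at_id.
    exact: smooth_at_cst.
  exact: (c _ (smooth_at_near sq)).
apply: filterS => x' /smooth_at_diff dq; have D' := is_diff_slicer dq.
by rewrite diff_val.
Qed.

(* At a critical point of [h] the second derivative of [h \o K] sees only the
   first derivative of [K]. *)
Lemma diff_diff_comp_critical V W (K : V -> W) (h : W -> R) :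
  fin_dim W -> smooth_at K 0 -> smooth_at h (K 0) ->
  (forall v, 'd h (K 0) v = 0) ->
  forall a b b', 'd K 0 b = 'd K 0 b' ->
  'd (fun z => 'd (h \o K) z a) 0 b = 'd (fun z => 'd (h \o K) z a) 0 b'.
Proof.
move=> fW sK sh dh0 a b b' bb'; have [I [e [c [cc ce]]]] := fW.
(* The chain rule in coordinates, each summand being a product of two functions of [z]. *)
pose F z := \sum_i c i ('d K z a) * 'd h (K z) (e i).
have FE : \forall z \near (0 : V), F z = 'd (h \o K) z a.
  have shK := smooth_at_continuous sK (smooth_at_near sh).
  apply: filterS2 (smooth_at_near sK) shK => z sKz shz.
  rewrite (diff_comp (smooth_at_diff sKz) (smooth_at_diff shz)) /=.
  by rewrite [in RHS](ce ('d K z a)) linear_sum; apply: eq_bigr => i _; rewrite linearZ.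
have D i : is_diff 0 (fun z => c i ('d K z a) * 'd h (K z) (e i))
    (fun v => c i ('d K 0 a) * 'd (fun y => 'd h y (e i)) (K 0) ('d K 0 v)).
  have d1 : differentiable (fun z => c i ('d K z a)) 0.
    apply: differentiable_comp; first exact/smooth_at_diff/smooth_at_diff_dir.
    exact: linear_differentiable.
  have d2 : differentiable (fun y => 'd h y (e i)) (K 0).
    exact/smooth_at_diff/smooth_at_diff_dir.
  have d3 := smooth_at_diff sK.
  have d4 : differentiable (fun z => 'd h (K z) (e i)) 0.
    exact: (differentiable_comp d3 d2).
  have [d5 E] := diff_scale d1 d4.
  apply: DiffDef; first exact: d5.
  (* The term in which the first factor is differentiated carries ['d h (K 0) (e i)], which is
     zero. *)
  rewrite [LHS]E; apply/funext => v; rewrite dh0 scaler0 addr0.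
  by rewrite (diff_comp d3 d2).
have DF := is_diff_bigsum (index_enum I) D.
have [_ ->] := near_eq_differentiable FE (@ex_diff _ _ _ _ _ _ _ DF).
by rewrite diff_val; apply: eq_bigr => i _; rewrite bb'.
Qed.

End Slices.

(** * One Newton step depending on a parameter [y] *)

Section NewtonStep.
Variable R : realType.

Lemma cV_sum_delta d (y : 'cV[R]_d) : y = \sum_j y j 0 *: delta_mx j 0.
Proof. by rewrite {1}[y]matrix_sum_delta; under eq_bigr do rewrite big_ord1. Qed.

Lemma linear_cV d (L : {linear 'cV[R]_d -> R}) (y : 'cV[R]_d) :
  L y = \sum_j L (delta_mx j 0) * y j 0.
Proof.
rewrite {1}(cV_sum_delta y) linear_sum; apply: eq_bigr => j _.
by rewrite linearZ mulrC.
Qed.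

(** Let [H y] be the Hessian of the slice at [y]. The gradient at [x = 0] vanishes for [y = 0], and
    the mixed-derivative hypothesis makes its linear part [H 0 *m y]. So [H y] applied to [y] plus
    the Newton vector is [(H y - H 0) *m y] minus a quadratic remainder, and the inverses of [H y]
    are uniformly bounded. *)
Lemma newton_step d (q : 'cV[R]_d * 'cV[R]_d -> R) : smooth_at q 0 ->
  (forall w, 'd q 0 (0, w) = 0) ->
  (forall u w, 'd (fun z => 'd q z (0, w)) 0 (u, 0) =
               'd (fun z => 'd q z (0, w)) 0 (0, u)) ->
  hess (fun x => q (0, x)) 0 \in unitmx ->
  exists2 C, 0 < C & \forall y \near (0 : 'cV[R]_d),
    hess (fun x => q (y, x)) 0 \in unitmx /\
    `|y + newton_map (fun x => q (y, x)) 0| <= C * `|y| ^+ 2.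
Proof.
move=> sq dq0 mixed uH0.
have fd := @fin_dim_matrix R d 1; have fp := fin_dim_prod fd fd.
(* [b] collects the entries of the gradient in [x] and [k] those of the Hessian in [x], as functions
   of both variables. *)
pose b j z := 'd q z (0, delta_mx j 0).
have sb j : smooth_at (b j) 0 by exact: smooth_at_diff_dir.
pose k i j z := 'd (b j) z (0, delta_mx i 0).
have sk i j : smooth_at (k i j) 0 by exact: smooth_at_diff_dir.
have [C1 C10 HC1] : exists2 C, 0 < C & \forall z \near (0 : 'cV[R]_d * 'cV[R]_d),
    forall i, `|b i z - b i 0 - 'd (b i) 0 z| <= C * `|z| ^+ 2.
  apply: (@near_le_finite _ _ _ (nbhs_filter (0 : 'cV[R]_d * 'cV[R]_d)) _
    (fun i z => `|b i z - b i 0 - 'd (b i) 0 z|) (fun z => `|z| ^+ 2)).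
    by move=> z; exact: exprn_ge0.
  move=> i.
  exact: (taylor2 fp (sb i)).
have [C2 C20 HC2] : exists2 C, 0 < C & \forall z \near (0 : 'cV[R]_d * 'cV[R]_d),
    forall ij : 'I_d * 'I_d, `|k ij.1 ij.2 z - k ij.1 ij.2 0| <= C * `|z|.
  apply: (@near_le_finite _ _ _ (nbhs_filter (0 : 'cV[R]_d * 'cV[R]_d)) _
    (fun ij z => `|k ij.1 ij.2 z - k ij.1 ij.2 0|) (fun z => `|z|)) => // ij.
  have [C C0 HC] := differentiable_lipschitz (smooth_at_diff (sk ij.1 ij.2)).
  by exists C => //; apply: filterS HC => z; rewrite subr0.
have [H HD] : exists H : 'cV[R]_d -> 'M[R]_d,
    forall y, H y = hess (fun x => q (y, x)) 0 by eexists.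
rewrite -HD in uH0.
have [C3 C30 HC3] := unitmx_bounded_below uH0.
have cy : {for (0 : 'cV[R]_d), continuous (fun y : 'cV[R]_d => (y, 0 : 'cV[R]_d))}.
  apply/smooth_at_continuous/smooth_at_pair; first exact: smooth_at_id.
  exact: smooth_at_cst.
have nE (y : 'cV[R]_d) : `|(y, 0 : 'cV[R]_d)| = `|y|.
  by rewrite prod_normE /= normr0 max_l.
have N0 := near_comp cy (smooth_at_near sq).
have HE y i j : smooth_at q (y, 0) -> H y i j = k i j (y, 0).
  by move=> sqy; rewrite HD; exact: hess_slicer.
have Hnear : \forall y \near (0 : 'cV[R]_d), `|H y - H 0| <= C2 * `|y|.
  apply: filterS2 N0 (near_comp cy HC2) => y sqy Hy; apply: mx_norm_le => [|i j].
    by rewrite mulr_ge0 // ltW.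
  rewrite sub_mxE (HE _ _ _ sqy).
  rewrite (HE _ _ _ sq).
  rewrite -(nE y).
  exact: (Hy (i, j)).
have Hcvg : {for 0, continuous H}.
  apply: lipschitz_continuous_at C20 _.
  by apply: filterS Hnear => y; rewrite subr0.
(* [C3] bounds the inverse Hessians, [d%:R * C2] comes from [(H y - H 0) *m y], and [C1] from the
   Taylor remainder of the gradient. *)
exists (C3 * (d%:R * C2 + C1)).
  by rewrite mulr_gt0 // ltr_wpDl // mulr_ge0 // ltW.
have {}HC3 := @near_comp _ _ H _ _ Hcvg HC3.
have {}HC1 := near_comp cy HC1.
near=> y.
have sqy : smooth_at q (y, 0) by near: y.
have HH : `|H y - H 0| <= C2 * `|y| by near: y.
have [uH bH] : H y \in unitmx /\ forall x : 'cV[R]_d, `|x| <= C3 * `|H y *m x|.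
  by near: y.
have Hy : forall i, `|b i (y, 0) - b i 0 - 'd (b i) 0 (y, 0)|
    <= C1 * `|(y, 0 : 'cV[R]_d)| ^+ 2 by near: y.
rewrite -HD; split=> //; rewrite /newton_map -HD sub0r; apply: (le_trans (bH _)).
rewrite -mulrA ler_pM2l // mulmxDr mulmxN mulmxA mulmxV // mul1mx.
set r : 'cV[R]_d := \col_i (b i (y, 0) - b i 0 - 'd (b i) 0 (y, 0)).
(* [mixed] trades the direction [(y, 0)] for [(0, y)]; Schwarz symmetry then matches the order of
   the indices in [H 0]. *)
have dbE i : 'd (b i) 0 (y, 0) = (H 0 *m y) i 0.
  rewrite /b mixed -/(b i) mxE.
  have D v : 'd (b i) 0 (0, v) = 'd (fun x => b i (0, x)) 0 v.
    have D := @is_diff_slicer _ _ _ _ (b i) 0 0 (smooth_at_diff (sb i)).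
    by rewrite [in RHS]diff_val.
  rewrite D linear_cV; apply: eq_bigr => j _; congr (_ * _).
  rewrite -D (HE _ _ _ sq).
  exact: (diff_diff_sym (0, delta_mx i 0) (0, delta_mx j 0) fp sq).
have rE i : r i 0 = b i (y, 0) - (H 0 *m y) i 0.
  by rewrite mxE [b i 0]dq0 subr0 dbE.
have -> : H y *m y - grad (fun x => q (y, x)) 0 = (H y - H 0) *m y - r.
  rewrite mulmxBl; apply/colP => i; rewrite !sub_mxE rE.
  rewrite grad_slicer; last exact: smooth_at_diff.
  by rewrite opprB addrA subrK.
apply: (le_trans (ler_normB _ _)); rewrite mulrDl; apply: lerD.
  apply: (le_trans (mulmx_norm _ _)); rewrite -!mulrA ler_wpM2l // expr2 mulrA.
  by rewrite ler_wpM2r.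
apply: mx_norm_le => [|i j]; first by rewrite mulr_ge0 ?exprn_ge0 // ltW.
by rewrite ord1 mxE -(nE y).
Unshelve. all: by end_near. Qed.
End NewtonStep.

(** * Local parametrizations and tangent vectors *)

Section LocalParametrization.
Variables (R : realType) (m n : nat).
Local Notation d := (m * (n - m))%N.
Local Notation Gr := (@Gr R m n).
Variables (P : 'M[R]_n) (phi : 'cV[R]_d -> 'M[R]_n).
Hypothesis hphi : local_parametrization P phi.

Lemma local_param_Gr x : Gr (phi x).
Proof. by case: hphi. Qed.

Lemma local_param0 : phi 0 = P.
Proof. by case: hphi. Qed.

Lemma local_param_smooth x : smooth_at phi x.
Proof. by case: hphi => _ s _ _; exact: smooth_onT. Qed.

Lemma rel_open_near (A : set 'M[R]_n) (Q : 'M[R]_n) : rel_open Gr A -> A Q ->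
  \forall Q' \near Q, Gr Q' -> A Q'.
Proof.
move=> [ O oO ->] [ OQ _]; have : nbhs Q O by exact: open_nbhs_nbhs.
by apply: filterS => Q' OQ' GQ'.
Qed.

(** The given inverse is smooth only on the relatively open set [A]. A local extension [F] to an
    open set of matrices has a full differential at [P] and keeps its values on [A], which contains
    every point of [Gr] close to [P]. *)
Lemma local_param_inverse : exists psi : 'M[R]_n -> 'cV[R]_d,
  [/\ smooth_at psi P, psi P = 0,
      \forall y \near (0 : 'cV[R]_d), psi (phi y) = y &
      \forall Q \near P, Gr Q -> phi (psi Q) = Q].
Proof.
have [_ _ phi0 [W [A [psi [[oW W0] oA phiW psiK spsi]]]]] := hphi.
have AP : A P by rewrite -phi0 -phiW; exists 0.
have psiP : psi P = 0 by rewrite -phi0 psiK.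
have nA := rel_open_near oA AP.
have [ O [F [oO OP CF FE]]] := spsi P AP.
have nO : nbhs P O by exact: open_nbhs_nbhs.
exists F; split.
- by exists O.
- by rewrite FE.
- have nW : nbhs (0 : 'cV[R]_d) W by exact: open_nbhs_nbhs.
  rewrite -phi0 in nO.
  have nO' := near_comp (smooth_at_continuous (local_param_smooth 0)) nO.
  apply: filterS2 nW nO' => y Wy Oy; rewrite FE ?psiK //.
  by rewrite -phiW; exists y.
- apply: filterS2 nO nA => Q OQ nQ /nQ AQ; rewrite FE //.
  by move: AQ; rewrite -phiW => -[y Wy <-]; rewrite psiK.
Qed.

(** Differentiating [psi \o phi = id] at [0] provides a left inverse of ['d phi 0]. *)
Lemma local_param_diff_inj v : 'd phi 0 v = 0 -> v = 0.
Proof.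
have [psi [spsi _ psiK _]] := local_param_inverse.
have dphi := smooth_at_diff (local_param_smooth 0).
have dpsi : differentiable psi (phi 0).
  by rewrite local_param0; exact: smooth_at_diff.
have psiK' : \forall y \near (0 : 'cV[R]_d), id y = (psi \o phi) y.
  by apply: filterS psiK.
have E : v = 'd psi (phi 0) ('d phi 0 v).
  apply: etrans (diff_compE v dphi dpsi).
  apply: etrans (near_eq_diff v psiK' (smooth_at_id _)).
  exact/esym/diff_idE.
by move=> dv; rewrite E dv linear0.
Qed.

(** A curve in [Gr] through [P] factors near time [0] as [phi \o (psi \o c)], so its velocity lies
    in the range of ['d phi 0]. *)
Lemma tangent_local_param (c : R -> 'M[R]_n) :
  Gr_curve m P c -> exists v, derive1 c 0 = 'd phi 0 v.
Proof.
move=> [cGr /(smooth_onT 0) sc c0].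
have [psi [spsi psiP _ phiK]] := local_param_inverse.
rewrite -c0 in spsi psiP phiK.
have dc := smooth_at_diff sc; have dpsi := smooth_at_diff spsi.
exists ('d psi (c 0) ('d c 0 1)); rewrite derive1E deriveE //.
have K : \forall t \near (0 : R), c t = (phi \o (psi \o c)) t.
  apply: filterS (near_comp (smooth_at_continuous sc) phiK) => t.
  by move=> /(_ (cGr t)) /= ->.
have dphi : differentiable phi ((psi \o c) 0).
  exact/smooth_at_diff/local_param_smooth.
have E1 : 'd c 0 1 = 'd (phi \o (psi \o c)) 0 1 := near_eq_diff _ K sc.
apply: (etrans E1).
apply: (etrans (diff_compE _ (differentiable_comp dc dpsi) dphi)).
by rewrite [(psi \o c) 0]psiP; congr ('d phi 0 _); exact: diff_compE.
Qed.

Lemma local_param_curve v : Gr_curve m P (fun t => phi (t *: v)).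
Proof.
split; [by move=> t; exact: local_param_Gr| |by rewrite scale0r local_param0].
apply: smooth_at_on; first exact: openT.
move=> t _; apply: (@smooth_at_comp _ _ _ _ (fun t : R => t *: v) phi).
- exact: fin_dim_matrix.
- exact: smooth_at_line.
- exact: local_param_smooth.
Qed.

Lemma derive1_line (W : normedModType R) (h : 'cV[R]_d -> W) (v : 'cV[R]_d) t :
  differentiable h (t *: v) -> derive1 (fun t => h (t *: v)) t = 'd h (t *: v) v.
Proof.
move=> dh; rewrite derive1E.
have -> : (fun t => h (t *: v)) = (fun t => h (0 + t *: v)).
  by apply/funext => s; rewrite add0r.
rewrite -[t *: v]add0r in dh *.
by have [_ ->] := is_derive_line dh.
Qed.

(** * The objective function in local coordinates *)

Variables (f : 'M[R]_n -> R) (hf : smooth_on Gr f).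
Local Notation h := (f \o phi).

Lemma smooth_at_local x : smooth_at h x.
Proof.
apply: (@smooth_on_comp _ _ _ _ Gr) => //.
- exact: fin_dim_matrix.
- exact: local_param_smooth.
- by apply: filterE => y; exact: local_param_Gr.
Qed.

Lemma critical_local v : critical_point m f P -> 'd h 0 v = 0.
Proof.
move=> [_ /(_ _ (local_param_curve v))].
rewrite (_ : f \o _ = fun t => h (t *: v)) //.
by rewrite derive1_line scale0r //; exact/smooth_at_diff/smooth_at_local.
Qed.

Lemma derive2_local v :
  derive1n 2 (f \o (fun t => phi (t *: v))) 0 = 'd (fun x => 'd h x v) 0 v.
Proof.
rewrite /derive1n /= derive1E.
have E : derive1 (f \o (fun t => phi (t *: v))) = fun t => 'd h (t *: v) v.
  apply/funext => t; rewrite (_ : f \o _ = fun t => h (t *: v)) //.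
  by rewrite derive1_line //; exact/smooth_at_diff/smooth_at_local.
rewrite E -derive1E (@derive1_line _ (fun x => 'd h x v)) scale0r //.
exact/smooth_at_diff/smooth_at_diff_dir/smooth_at_local.
Qed.

(** The pullback of [B] by [A = 'd phi 0] and the second differential [B2] of [h] have the same
    quadratic form, as seen on the curves [phi (t *: v)]; both are symmetric and bilinear, so they
    are equal. If [x] is in the kernel of the Hessian matrix, [A x] is then [B]-orthogonal to all
    tangent vectors, so [A x = 0], and [x = 0] by injectivity of [A]. *)
Lemma hess_local_unit : nondegenerate_critical_point m f P -> hess h 0 \in unitmx.
Proof.
move=> [crit [B [Bsym Blin Bquad] nondeg]].
pose A := 'd phi 0; pose B2 v w := 'd (fun x => 'd h x w) 0 v.
have sh := smooth_at_local 0.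
have dphi := smooth_at_diff (local_param_smooth 0).
have derA v : derive1 (fun t => phi (t *: v)) 0 = A v.
  by rewrite derive1_line scale0r.
have tA v : tangent m P (A v).
  by exists (fun t => phi (t *: v)); [exact: local_param_curve|].
have BA v : B (A v) (A v) = B2 v v.
  by rewrite -derA -(Bquad _ (local_param_curve v)) derive2_local.
have B2sym v w : B2 v w = B2 w v.
  by apply: diff_diff_sym => //; exact: fin_dim_matrix.
have B2Dl v v' w : B2 (v + v') w = B2 v w + B2 v' w
  by exact: (linearD ('d (fun x => 'd h x w) 0)).
have BDl v v' w : B (A (v + v')) (A w) = B (A v) (A w) + B (A v') (A w).
  by rewrite (linearD A) -[A v]scale1r Blin // mul1r scale1r.
have BDr v w w' : B (A v) (A (w + w')) = B (A v) (A w) + B (A v) (A w').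
  by rewrite Bsym // BDl; congr (_ + _); exact: Bsym.
have B2Dr v w w' : B2 v (w + w') = B2 v w + B2 v w'.
  by rewrite B2sym B2Dl; congr (_ + _); exact: B2sym.
(* Polarization: expand both quadratic forms at [v + w]. *)
have pol v w : B (A v) (A w) = B2 v w.
  have := BA (v + w); rewrite BDl !BDr !BA B2Dl !B2Dr (Bsym (A w) (A v)) //.
  rewrite (B2sym w v).
  move: (B _ _) (B2 v w) (B2 v v) (B2 w w) => x1 x2 x3 x4; lra.
apply: unitmx_ker => x Hx; apply: local_param_diff_inj; apply: nondeg => // eta.
move=> [c cc <-]; have [v ->] := tangent_local_param cc.
rewrite pol B2sym /B2 linear_cV big1 // => i _.
suff -> : 'd (fun y => 'd h y x) 0 (delta_mx i 0) = (hess h 0 *m x) i 0.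
  by rewrite Hx mxE mul0r.
rewrite -/(B2 _ _) B2sym /B2 linear_cV mxE; apply: eq_bigr => j _.
congr (_ * _); apply: etrans (esym (hessE i j sh)).
exact: (B2sym (delta_mx j 0) (delta_mx i 0)).
Qed.
End LocalParametrization.

(** * The Newton iteration near the critical point *)

Section NewtonGrassmannian.
Variables (R : realType) (m n : nat).
Local Notation d := (m * (n - m))%N.
Local Notation Gr := (@Gr R m n).
Variables (f : 'M[R]_n -> R) (Ps : 'M[R]_n).
Hypothesis hf : smooth_on Gr f.
Hypothesis hPs : nondegenerate_critical_point m f Ps.
Variables mu nu : 'M[R]_n -> 'cV[R]_d -> 'M[R]_n.
Hypotheses (hmu : param_family mu) (hnu : param_family nu).
Hypotheses (smu : locally_smooth_around Ps mu) (snu : locally_smooth_around Ps nu).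
Hypothesis hD : forall v : 'cV[R]_d, 'd (mu Ps) 0 v = 'd (nu Ps) 0 v.

Local Notation phi := (mu Ps).

Lemma critical_Gr : Gr Ps.
Proof. by case: hPs => -[]. Qed.

Let hphi : local_parametrization Ps phi := hmu critical_Gr.

(** For [y] near [0] the point [phi y] is in [Gr] and close to [Ps], hence in the set [U] on which
    the family is jointly smooth. *)
Lemma smooth_at_family (ka : 'M[R]_n -> 'cV[R]_d -> 'M[R]_n) :
  locally_smooth_around Ps ka ->
  smooth_at (fun z : 'cV[R]_d * 'cV[R]_d => ka (phi z.1) z.2) 0.
Proof.
move=> [U [oU UPs sU]]; have fd := @fin_dim_matrix R d 1.
have s1 : smooth_at (fun z : 'cV[R]_d * 'cV[R]_d => phi z.1) 0.
  apply: (@smooth_at_comp _ _ _ _ fst phi) => //; first exact: smooth_at_fst.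
  exact: local_param_smooth hphi _.
apply: (@smooth_on_comp _ _ _ _ (U `*` setT)
  (fun z : 'cV[R]_d * 'cV[R]_d => (phi z.1, z.2)) (fun z => ka z.1 z.2)) => //.
- by apply: fin_dim_prod => //; exact: fin_dim_matrix.
- by apply: smooth_at_pair => //; exact: smooth_at_snd.
- have := rel_open_near oU UPs.
  rewrite -[in X in X -> _](local_param0 hphi) => nU.
  have nU' : \forall z \near (0 : 'cV[R]_d * 'cV[R]_d), Gr (phi z.1) -> U (phi z.1).
    exact: near_comp (smooth_at_continuous s1) nU.
  apply: filterS nU' => z Uz; split=> //=; apply: Uz.
  exact: local_param_Gr hphi _.
Qed.

Lemma newton_step_coordinates : exists2 C, 0 < C & \forall y \near (0 : 'cV[R]_d),
  hess (f \o mu (phi y)) 0 \in unitmx /\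
  `|y + newton_map (f \o mu (phi y)) 0| <= C * `|y| ^+ 2.
Proof.
have fd := @fin_dim_matrix R d 1; have fn := @fin_dim_matrix R n n.
have [psi [spsi psiPs psiK phiK]] := local_param_inverse hphi.
pose M (z : 'cV[R]_d * 'cV[R]_d) := mu (phi z.1) z.2.
have sM : smooth_at M 0 := smooth_at_family smu.
have MGr z : Gr (M z) by apply: (local_param_Gr (hmu (local_param_Gr hphi z.1))).
have M0 : M 0 = Ps by rewrite /M /= (local_param0 hphi) (local_param0 hphi).
have My0 y : M (y, 0) = phi y.
  by rewrite /M /= (local_param0 (hmu (local_param_Gr hphi y))).
have M0x x : M (0, x) = phi x by rewrite /M /= (local_param0 hphi).
pose K := psi \o M; pose h := f \o phi; pose q := f \o M.
have sK : smooth_at K 0 by apply: smooth_at_comp => //; rewrite M0.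
have K0 : K 0 = 0 by rewrite /K /= M0.
have sh : smooth_at h (K 0) by exact: smooth_at_local hphi _ hf _.
have dh0 v : 'd h (K 0) v = 0.
  by rewrite K0; apply: (critical_local hphi hf); case: hPs.
have sq : smooth_at q 0.
  by apply: (@smooth_on_comp _ _ _ _ Gr) => //; exact: filterE.
(* [M] takes values in [Gr], where [phi \o psi] is the identity near [Ps]. *)
have qhK : \forall z \near (0 : 'cV[R]_d * 'cV[R]_d), q z = (h \o K) z.
  have phiK' : \forall Q \near M 0, Gr Q -> phi (psi Q) = Q by rewrite M0.
  apply: filterS (near_comp (smooth_at_continuous sM) phiK') => z /(_ (MGr z)) E.
  by rewrite /q /h /K /= E.
have shK : smooth_at (h \o K) 0 by exact: smooth_at_comp.
(* [K] is the identity along both axes near [0], so its two partial differentials coincide; this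
   yields the mixed-derivative condition of [newton_step]. *)
have dK (v : 'cV[R]_d) : 'd K 0 (v, 0) = v /\ 'd K 0 (0, v) = v.
  have Kl : \forall y \near (0 : 'cV[R]_d), id y = K (y, 0).
    by apply: filterS psiK => y; rewrite /K /= My0 => ->.
  have Kr : \forall x \near (0 : 'cV[R]_d), id x = K (0, x).
    by apply: filterS psiK => x; rewrite /K /= M0x => ->.
  have sid := smooth_at_id (0 : 'cV[R]_d); have dK := smooth_at_diff sK.
  split.
    apply: (etrans (diff_slicel (y := 0) (x := 0) v dK)).
    by apply: (etrans (esym (near_eq_diff v Kl sid))); exact: diff_idE.
  apply: (etrans (diff_slicer (y := 0) (x := 0) v dK)).
  by apply: (etrans (esym (near_eq_diff v Kr sid))); exact: diff_idE.
have dqE w : \forall z \near (0 : 'cV[R]_d * 'cV[R]_d),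
    'd q z (0, w) = 'd (h \o K) z (0, w) := near_eq_diff_dir (0, w) qhK sq.
have sdq (w : 'cV[R]_d) := smooth_at_diff_dir (0, w) sq.
apply: (newton_step (q := q)) => //.
- move=> w; apply: (etrans (near_eq_diff (0, w) qhK sq)).
  apply: (etrans (diff_compE _ (smooth_at_diff sK) (smooth_at_diff sh))).
  exact: dh0.
- move=> u w; apply: (etrans (near_eq_diff (u, 0) (dqE w) (sdq w))).
  apply/esym; apply: (etrans (near_eq_diff (0, u) (dqE w) (sdq w))); apply/esym.
  apply: diff_diff_comp_critical => //.
  by have [-> ->] := dK u.
- have -> : (fun x => q (0, x)) = h by apply/funext => x; rewrite /q /= M0x.
  exact: hess_local_unit hphi _ hf hPs.
Qed.

(** The partial differentials at [0] of [L (y, x) = nu (phi y) x] are those of [phi] and of [nu Ps].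
    By [hD] they are equal, so the linear part depends on the sum of the two variables only. *)
Lemma family_expansion : exists2 C, 0 < C &
  \forall z \near (0 : 'cV[R]_d * 'cV[R]_d),
    `|nu (phi z.1) z.2 - Ps - 'd phi 0 (z.1 + z.2)| <= C * `|z| ^+ 2.
Proof.
have fd := @fin_dim_matrix R d 1.
pose L (z : 'cV[R]_d * 'cV[R]_d) := nu (phi z.1) z.2.
have sL : smooth_at L 0 := smooth_at_family snu.
have [C C0 HC] := taylor2_mx (fin_dim_prod fd fd) sL.
exists C => //; apply: filterS HC => z.
have nu0 : nu Ps 0 = Ps := local_param0 (hnu critical_Gr).
have L0 : L 0 = Ps by rewrite /L /= (local_param0 hphi).
have dL := smooth_at_diff sL.
have Ll : (fun y => L (y, 0)) = phi.
  apply/funext => y; rewrite /L /=.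
  exact: local_param0 (hnu (local_param_Gr hphi y)).
have Lr : (fun x => L (0, x)) = nu Ps.
  by apply/funext => x; rewrite /L /= (local_param0 hphi).
suff -> : 'd L 0 z = 'd phi 0 (z.1 + z.2) by rewrite L0.
have -> : z = (z.1, 0) + (0, z.2).
  by apply: injective_projections; rewrite /= ?addr0 ?add0r.
rewrite (linearD ('d L 0)) (linearD ('d phi 0)) /=.
have E1 : 'd L 0 (z.1, 0) = 'd phi 0 z.1.
  by apply: (etrans (diff_slicel (y := 0) (x := 0) z.1 dL));
    exact: (congr1 (fun g : 'cV[R]_d -> 'M[R]_n => 'd g 0 z.1) Ll).
have E2 : 'd L 0 (0, z.2) = 'd phi 0 z.2.
  apply: (etrans (diff_slicer (y := 0) (x := 0) z.2 dL)).
  apply: (etrans (congr1 (fun g : 'cV[R]_d -> 'M[R]_n => 'd g 0 z.2) Lr)).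
  exact/esym/hD.
by rewrite E1 E2 addr0 add0r.
Qed.

Lemma newton_grassmannian : exists2 C, 0 < C & \forall P \near Ps, Gr P ->
  hess (f \o mu P) 0 \in unitmx /\
  `|nu P (newton_map (f \o mu P) 0) - Ps| <= C * `|P - Ps| ^+ 2.
Proof.
have [C1 C10 H1] := newton_step_coordinates; have [C2 C20 H2] := family_expansion.
have dphi := smooth_at_diff (local_param_smooth hphi 0).
have [C3 C30 HA] := linear_lipschitz (diff_continuous dphi).
have [psi [spsi psiPs _ phiK]] := local_param_inverse hphi.
have [C4 C40 H4] := differentiable_lipschitz (smooth_at_diff spsi).
move: H1 => /nbhs_ballP[r1 /= r10 H1]; move: H2 => /nbhs_ballP[r2 /= r20 H2].
have nr (r : R) : 0 < r -> \forall P \near Ps, `|psi P| < r.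
  move=> r0; have : \forall y \near psi Ps, `|y| < r.
    rewrite psiPs; apply/nbhs_ballP; exists r => //= y.
    by rewrite -ball_normE /= sub0r normrN.
  exact: (near_comp (smooth_at_continuous spsi)).
(* With [y = psi P] and [s] the Newton vector, [4 * C2] is the Taylor remainder at [(y, s)], of norm
   at most twice that of [y]; [C3 * C1] bounds ['d phi 0 (y + s)]; [C4 ^+ 2] converts the square of
   [|y|] into that of [|P - Ps|]. *)
exists ((4 * C2 + C3 * C1) * C4 ^+ 2).
  by rewrite mulr_gt0 ?exprn_gt0 // addr_gt0 // mulr_gt0.
have nr1 := nr _ r10.
(* Half of [r2] is enough because [(y, s)] has norm at most twice that of [y]. *)
have nr2 : \forall P \near Ps, `|psi P| < r2 / 2 by apply: nr; rewrite divr_gt0.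
(* This makes the quadratic bound on [y + s] at most [|y|], from which the bound on [s] follows. *)
have nr3 : \forall P \near Ps, `|psi P| < C1^-1 by apply: nr; rewrite invr_gt0.
near=> P => GP.
have yr1 : `|psi P| < r1 by near: P.
have yr2 : `|psi P| < r2 / 2 by near: P.
have yr3 : `|psi P| < C1^-1 by near: P.
have yP : `|psi P| <= C4 * `|P - Ps|.
  by rewrite -[psi P]subr0 -psiPs; near: P.
have phiy : phi (psi P) = P by move: GP; near: P.
move: (psi P) yr1 yr2 yr3 yP phiy => y yr1 yr2 yr3 yP phiy.
have [|uH] := H1 y; first by rewrite -ball_normE /= sub0r normrN.
rewrite phiy in uH *; set s := newton_map _ _ => Hs; split=> //.
have n0 : 0 <= `|y| by [].
have Hs' : `|y + s| <= `|y|.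
  apply: (le_trans Hs); rewrite expr2 mulrA ler_piMl //.
  by rewrite -ler_pdivlMl // mulr1 ltW.
have Hz : `|(y, s)| <= 2 * `|y|.
  rewrite prod_normE /= ge_max mulr2n mulrDl mul1r lerDl n0 /=.
  have -> : s = (y + s) - y by rewrite addrC addKr.
  by apply: (le_trans (ler_normB _ _)); rewrite lerD.
have := H2 (y, s); rewrite -ball_normE /= sub0r normrN phiy => {}H2.
have {H2} B : `|nu P s - Ps - 'd phi 0 (y + s)| <= C2 * (2 * `|y|) ^+ 2.
  apply: (le_trans (H2 _)).
    by apply: (le_lt_trans Hz); rewrite mulrC -ltr_pdivlMr.
  by rewrite ler_pM2l // ler_sqr ?nnegrE // mulr_ge0.
apply: (@le_trans _ _ ((4 * C2 + C3 * C1) * `|y| ^+ 2)); last first.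
  rewrite -mulrA -exprMn ler_pM2l; last by rewrite addr_gt0 // mulr_gt0.
  by rewrite ler_sqr ?nnegrE // mulr_ge0 // ltW.
rewrite -[X in `|X|](subrK ('d phi 0 (y + s))).
apply: (le_trans (ler_normD _ _)); rewrite mulrDl; apply: lerD.
  by apply: (le_trans B); rewrite exprMn mulrA [C2 * _]mulrC -natrX.
by apply: (le_trans (HA _)); rewrite -mulrA ler_pM2l.
Unshelve. all: by end_near. Qed.

End NewtonGrassmannian.

(** * From a one-step estimate to quadratic convergence *)

(** Within distance [1 / (2 * C)] of [l] the quadratic bound at least halves the distance to [l], so
    iterates never leave the ball and converge geometrically. [S] will be the Grassmannian and [Q]
    the invertibility of the Hessian. *)
Lemma quadratic_cvg_iter (R : realType) (n : nat) (S : set 'M[R]_n)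
    (T : 'M[R]_n -> 'M[R]_n) (l : 'M[R]_n) (C : R) (Q : 'M[R]_n -> Prop) :
  0 < C -> (forall P, S P -> S (T P)) ->
  (\forall P \near l, S P -> Q P /\ `|T P - l| <= C * `|P - l| ^+ 2) ->
  \forall P \near l, S P ->
    (forall k, Q (iter k T P)) /\ quadratic_cvg (fun k => iter k T P) l.
Proof.
move=> C0 ST /nbhs_ballP[r /= r0 H].
(* [r] gives validity of the one-step estimate, the other bound gives the halving. *)
pose e := Num.min r (2 * C)^-1.
have e0 : 0 < e by rewrite lt_min r0 invr_gt0 mulr_gt0.
apply/nbhs_ballP; exists e => //= P0; rewrite -ball_normE /= distrC => P0e SP0.
have main k : S (iter k T P0) /\ `|iter k T P0 - l| <= `|P0 - l| * 2^-1 ^+ k.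
  elim: k => [|k [Sk Hk]]; first by rewrite expr0 mulr1.
  have ke : `|iter k T P0 - l| < e.
    apply: (le_lt_trans Hk); apply: (le_lt_trans _ P0e); rewrite ler_piMr //.
    by rewrite exprn_ile1 // invf_le1 // ler1n.
  split; first exact: ST.
  have [||_ HT] := H (iter k T P0) => //.
    by rewrite -ball_normE /= distrC; apply: (lt_le_trans ke); rewrite ge_min lexx.
  apply: (le_trans HT); rewrite [2^-1 ^+ k.+1]exprSr [leRHS]mulrA.
  apply: (@le_trans _ _ (`|iter k T P0 - l| * 2^-1)); last by rewrite ler_wpM2r.
  rewrite expr2 mulrA mulrC ler_wpM2l // mulrC -ler_pdivlMr //.
  apply: (le_trans (ltW ke)); rewrite ge_min; apply/orP; right.
  by rewrite invfM.
have HP k : Q (iter k T P0) /\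
    `|T (iter k T P0) - l| <= C * `|iter k T P0 - l| ^+ 2.
  have [Sk Hk] := main k; apply: H => //; rewrite -ball_normE /= distrC.
  apply: (le_lt_trans Hk); apply: (@le_lt_trans _ _ `|P0 - l|).
    by rewrite ler_piMr // exprn_ile1 // invf_le1 // ler1n.
  by apply: (lt_le_trans P0e); rewrite ge_min lexx.
split=> [k|]; first by have [] := HP k.
split; last by exists C => k; have [] := HP k.
apply/cvgrPdist_le => eps eps0.
have : geometric `|P0 - l| 2^-1 @ \oo --> (0 : R).
  by apply: cvg_geometric; rewrite ger0_norm // invf_lt1 // ltr1n.
move=> /cvgrPdist_le/(_ eps eps0); apply: filterS => k; rewrite sub0r normrN => Hk.
rewrite distrC; have [_ Hk'] := main k; apply: (le_trans Hk').
by apply: le_trans Hk; rewrite ler_norm.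
Qed.

Theorem theorem8 (R : realType) (m n : nat) (hm : (1 <= m)%N) (hmn : (m <= n)%N)
  (f : 'M[R]_n -> R) (hf : smooth_on (@Gr R m n) f)
  (Ps : 'M[R]_n) (hPs : nondegenerate_critical_point m f Ps)
  (mu nu : 'M[R]_n -> 'cV[R]_(m * (n - m)) -> 'M[R]_n)
  (hmu : param_family mu) (hnu : param_family nu)
  (smu : locally_smooth_around Ps mu) (snu : locally_smooth_around Ps nu)
  (hD : forall v : 'cV[R]_(m * (n - m)), 'd (mu Ps) 0 v = 'd (nu Ps) 0 v) :
  exists V : set 'M[R]_n,
    [/\ rel_open (@Gr R m n) V, V Ps &
        forall P0 : 'M[R]_n, V P0 ->
          (forall k : nat,
             hess (f \o mu (newton_seq f mu nu P0 k)) 0 \in unitmx) /\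
          quadratic_cvg (newton_seq f mu nu P0) Ps].
Proof.
have [C C0 HC] := newton_grassmannian hf hPs hmu hnu smu snu hD.
(* Every value of [nu P] lies in the Grassmannian, whatever the Newton vector is, so the iteration
   never leaves it. *)
have HT P : Gr m P -> Gr m (nu P (newton_map (f \o mu P) 0)).
  by move=> GP; exact: local_param_Gr (hnu _ GP) _.
have [ O [oO OPs] HO] := near_open_nbhs (quadratic_cvg_iter C0 HT HC).
exists (O `&` @Gr R m n); split; first by exists O.
  by split=> //; exact: critical_Gr hPs.
by move=> P0 [ OP0 GP0]; exact: HO.
Qed.
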